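(* Let $G_1, G_2, G_3$ be three directed graphs on a common set of $n$ vertices. If $e(G_i) \geq \frac{5}{9}n^2$ for every $i \in \{1,2,3\}$, then there exists a rainbow directed triangle.
   Context: A directed graph $G$ consists of a vertex set $V(G)$ and an edge set $E(G)$ of ordered pairs of distinct vertices (no loops, no multiple edges; both $(u,v)$ and $(v,u)$ may be present). $e(G)=|E(G)|$. The edges of $G_i$ are thought of as having color $i$. A rainbow directed triangle is a triple of distinct vertices $u,v,w$ together with pairwise distinct colors $a,b,d \in\{1,2,3\}$ such that $(u,v)\in E(G_a)$, $(v,w)\in E(G_b)$, $(w,u)\in E(G_d)$. *)

(* Defs.v *)
From HB Require Import structures.
From mathcomp Require Import all_boot all_order all_algebra.

Set Implicit Arguments.
Unset Strict Implicit.
Unset Printing Implicit Defensive.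

Record digraph (T : finType) := Digraph {
  edge :> rel T;
  edge_irrefl : irreflexive edge
}.

Definition edges (T : finType) (G : digraph T) : {set T * T} :=
  [set p | edge G p.1 p.2].

Definition rainbow_directed_triangle (T : finType) (G : 'I_3 -> digraph T)
    (u v w : T) (a b d : 'I_3) : Prop :=
  [/\ uniq [:: u; v; w], uniq [:: a; b; d],
      (u, v) \in edges (G a), (v, w) \in edges (G b)
    & (w, u) \in edges (G d)].

(* Main.v *)
(** Suppose there is no rainbow triangle. For a colour [j], count an arc with the
    number of its colours other than [j]. If [j] is on [u -> v], then [v -> z] and
    [z -> u] together carry at most two colours other than [j]. Call a directed
    cycle typed by [i] if all its arcs carry the two colours other than [i]; by
    the preceding remark, such a cycle absorbs its share of the colours [j <> i].
    Take vertex-disjoint typed cycles covering as many vertices as possible: [x_j]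
    vertices by cycles of type [j], and [r] vertices uncovered. No uncovered
    vertex can be inserted in a cycle, and there is no typed cycle on two or
    three uncovered vertices. Writing [E_j = e(G_i) + e(G_k) - n^2 >= n^2 / 9] with
    [{i, j, k} = {1, 2, 3}], this gives
    - [E_j <= x_j^2 + r x_j + r^2 / 2],
    - [E_i + E_j <= x_i^2 + x_j^2 + r (x_i + x_j) + 3 r^2 / 4], where Mantel's theorem
      bounds the number of uncovered pairs carrying four colours with [k] in
      both directions,
    - [E_1 + E_2 + E_3 < x_1^2 + x_2^2 + x_3^2 + r^2 / 3], from a maximal matching
      of uncovered pairs carrying four colours.
    The first two bounds imply [x_j <= (n + r) / 3] for all [j], so the sum of the
    [x_j^2] is at most [(n + r) (n - r) / 3], which contradicts the third. *)

Require Import Defs.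
From HB Require Import structures.
From mathcomp Require Import all_boot all_order all_algebra.
From mathcomp Require Import fingroup perm zify lra.

Set Implicit Arguments.
Unset Strict Implicit.
Unset Printing Implicit Defensive.

Import Order.TTheory GRing.Theory Num.Theory.
Local Open Scope nat_scope.

(** * Labels of arcs *)

(* The three components tell which of the colours 0, 1, 2 are on an arc. *)
Definition label := (bool * bool * bool)%type.

Definition has_colour (j : nat) (l : label) : bool :=
  match j with 0 => l.1.1 | 1 => l.1.2 | _ => l.2 end.

Definition ncol (l : label) : nat := l.1.1 + l.1.2 + l.2.

Definition ncol_but (j : nat) (l : label) : nat :=
  match j with 0 => l.1.2 + l.2 | 1 => l.1.1 + l.2 | _ => l.1.1 + l.1.2 end.

Definition has_others (j : nat) (l : label) : bool := ncol_but j l == 2.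

Definition not_rainbow (l1 l2 l3 : label) : bool :=
  all (fun a => all (fun b => all (fun d =>
    uniq [:: a; b; d] ==>
    ~~ [&& has_colour a l1, has_colour b l2 & has_colour d l3])
    [:: 0; 1; 2]) [:: 0; 1; 2]) [:: 0; 1; 2].

Definition labels : seq label :=
  let B := [:: true; false] in
  [seq (xy, z) | xy <- [seq (x, y) | x <- B, y <- B], z <- B].

Lemma mem_labels l : l \in labels.
Proof. by case: l => [[[] []] []]. Qed.

Lemma all_labels (P : pred label) : all P labels -> forall l, P l.
Proof. by move=> /allP Pl l; apply/Pl/mem_labels. Qed.

Lemma all_labels3 (P : label -> label -> label -> bool) :
  all (fun a => all (fun b => all (P a b) labels) labels) labels ->
  forall a b c, P a b c.
Proof.
by move=> /all_labels P3 a b c; move: (P3 a) => /all_labels/(_ b)/all_labels.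
Qed.

(** Let [i], [k] be the other two colours. Absence of a rainbow triangle forbids [i] on [l2] with
    [k] on [l3], and [k] on [l2] with [i] on [l3]; each of these two pairs of incidences thus
    contributes at most one. *)
Lemma bracket (j : 'I_3) l1 l2 l3 :
  not_rainbow l1 l2 l3 -> has_colour j l1 ->
  ncol_but j l2 + ncol_but j l3 <= 2.
Proof.
move=> + h; apply: contraTT => le2; move: l1 l2 l3 h le2.
suff H a b c : has_colour j a && ~~ (ncol_but j b + ncol_but j c <= 2)
    ==> ~~ not_rainbow a b c.
  by move=> a b c h1 h2; have := H a b c; rewrite h1 h2.
move: a b c; apply: all_labels3.
by case: j => [[|[|[|]]]] // ?; vm_compute.
Qed.

(** Colour [j] on one of [l2], [l3] forces the other to carry no colour but [j]. If [j] is on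
    neither, then [ncol] agrees with [ncol_but j] on both. *)
Lemma typed_ncol (j : 'I_3) l1 l2 l3 :
  not_rainbow l1 l2 l3 -> has_others j l1 ->
  ncol l2 + ncol l3 <= 2 + has_others j l2 + has_others j l3.
Proof.
move=> nr h; move: l1 l2 l3 nr h.
suff H a b c : has_others j a ==> ~~ (ncol b + ncol c <=
   2 + has_others j b + has_others j c) ==> ~~ not_rainbow a b c.
  move=> a b c nr h; have := H a b c; rewrite h nr.
  by case: (_ <= _).
move: a b c; apply: all_labels3.
by case: j => [[|[|[|]]]] // ?; vm_compute.
Qed.

Lemma ncol_but_typed (j : 'I_3) l : ncol_but j l <= 1 + has_others j l.
Proof. by case: j l => [[|[|[|]]]] // ? [[[] []] []]. Qed.

Lemma has_others_colour (i j : 'I_3) l :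
  i != j -> has_others i l -> has_colour j l.
Proof. by case: i j l => [[|[|[|]]]] // ? [[|[|[|]]]] // ? [[[] []] []]. Qed.

Definition digon_free (l l' : label) : bool :=
  all (fun j => ~~ (has_others j l && has_others j l')) [:: 0; 1; 2].

Definition triangle_free (l1 l2 l3 : label) : bool :=
  all (fun j => ~~ [&& has_others j l1, has_others j l2 & has_others j l3])
    [:: 0; 1; 2].

Lemma digon_free_ncol l l' : digon_free l l' -> ncol l + ncol l' <= 4.
Proof. by case: l l' => [[[] []] []] [[[] []] []]. Qed.

Lemma digon_free_ncol_but (j : 'I_3) l l' :
  digon_free l l' -> ncol_but j l + ncol_but j l' <= 3.
Proof. by case: j l l' => [[|[|[|]]]] // ? [[[] []] []] [[[] []] []]. Qed.

(* [a], [b], [c] are the labels of the arcs u -> v, v -> w, w -> u and [a'],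
   [b'], [c'] those of the reverse arcs. *)
Definition admissible (a a' b b' c c' : label) : bool :=
  [&& [&& digon_free a a', digon_free b b' & digon_free c c'],
      not_rainbow a b c, not_rainbow c' b' a',
      triangle_free a b c & triangle_free c' b' a'].

(* Conditionals are used because, unlike [==>] and [||], they are lazy under
   [vm_compute], so that most of the [8 ^ 6] cases are pruned. *)
Lemma all_admissible (H : label -> label -> bool)
    (Q : label -> label -> label -> label -> label -> label -> bool) :
  all (fun a => all (fun a' => if H a a' then
    all (fun b => all (fun b' => all (fun c => all (fun c' =>
      if Q a a' b b' c c' then true else ~~ admissible a a' b b' c c')
    labels) labels) labels) labels else true) labels) labels ->
  forall a a' b b' c c', H a a' -> admissible a a' b b' c c' ->
    Q a a' b b' c c'.
Proof.
move=> H6 a a' b b' c c' Haa adm.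
move: H6 => /all_labels/(_ a)/all_labels/(_ a'); rewrite Haa.
move=> /all_labels/(_ b)/all_labels/(_ b')/all_labels/(_ c)/all_labels/(_ c').
by rewrite adm; case: ifP.
Qed.

(** Four is the maximum that [digon_free] allows. *)
Definition heavy (a a' : label) : bool := ncol a + ncol a' == 4.

(** Verified by enumeration. The last clause is the equality case: opposite a full arc, a third
    vertex reaches 7 only by receiving full arcs from both ends or by sending full arcs to both. *)
Lemma heavy_sum a a' b b' c c' :
  heavy a a' -> admissible a a' b b' c c' ->
  [&& ncol b + ncol b' + ncol c + ncol c' <= 7,
      (ncol a == 2) ==> (ncol b + ncol b' + ncol c + ncol c' <= 6)
    & (ncol a == 3) && (ncol b + ncol b' + ncol c + ncol c' == 7) ==>
       [&& ncol b == 3, ncol c' == 3 & ncol b' == 1]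
    || [&& ncol c == 3, ncol b' == 3 & ncol c' == 1]].
Proof.
move: a a' b b' c c'; apply: all_admissible.
by vm_compute.
Qed.

Definition heavy_digon (k : nat) (a a' : label) : bool :=
  [&& heavy a a', has_colour k a & has_colour k a'].

(** This makes the graph of heavy pairs with [k] in both directions triangle-free, as Mantel's
    theorem requires. *)
Lemma heavy_digon_triangle_free (k : 'I_3) a a' b b' c c' :
  heavy_digon k a a' -> heavy_digon k b b' -> heavy_digon k c c' ->
  ~~ admissible a a' b b' c c'.
Proof.
move=> ha hb hc; apply/negP => adm.
suff: ~~ (heavy_digon k b b' && heavy_digon k c c') by rewrite hb hc.
move: a a' b b' c c' ha adm {hb hc}; apply: all_admissible.
by case: k => [[|[|[|]]]] // ?; vm_compute.
Qed.

Lemma full_ncol l1 l2 l3 :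
  not_rainbow l1 l2 l3 -> ncol l1 = 3 -> ncol l2 = 3 -> ncol l3 = 0.
Proof.
by case: l1 l2 l3 => [[[] []] []] // [[[] []] []] // [[[] []] []].
Qed.

(** * Sums over pairs of vertices, Mantel's theorem, maximal matchings *)

Section PairSums.

Variable T : finType.
Implicit Types (d : T -> T -> nat) (A B D F Z : {set T}).

Definition pair_sum d A B := \sum_(u in A) \sum_(v in B) d u v.

Lemma pair_sumC d A B :
  (forall u v, d u v = d v u) -> pair_sum d A B = pair_sum d B A.
Proof.
move=> dC; rewrite /pair_sum exchange_big; apply: eq_bigr => u _.
by apply: eq_bigr => v _; rewrite dC.
Qed.

Lemma pair_sumUl d A B D :
  [disjoint A & B] -> pair_sum d (A :|: B) D = pair_sum d A D + pair_sum d B D.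
Proof. by move=> dAB; rewrite /pair_sum -bigU //; apply: eq_bigl => u; rewrite inE. Qed.

Lemma pair_sum_square d D F :
  (forall u v, d u v = d v u) -> [disjoint D & F] ->
  pair_sum d (D :|: F) (D :|: F) =
    pair_sum d D D + 2 * pair_sum d D F + pair_sum d F F.
Proof.
move=> dC dDF; rewrite pair_sumUl // (pair_sumC D _ dC) (pair_sumC F _ dC).
rewrite !pair_sumUl // (pair_sumC F D dC); lia.
Qed.

Lemma leq_sum_cst A (f : T -> nat) k :
  (forall u, u \in A -> f u <= k) -> \sum_(u in A) f u <= #|A| * k.
Proof. by move=> le_f; rewrite -sum_nat_const; apply: leq_sum. Qed.

(** The deficit [t] on the diagonal yields a linear term; such terms make the last inequality of the
    whole argument strict. *)
Lemma pair_sum_diag d k t A :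
  {in A &, forall u v, d u v + t * (u == v) <= k} ->
  pair_sum d A A + t * #|A| <= k * #|A| ^ 2.
Proof.
move=> le_k.
suff: \sum_(u in A) (\sum_(v in A) d u v + t) <= #|A| * (#|A| * k).
  by rewrite big_split sum_nat_const /= -/(pair_sum d A A); nia.
apply: leq_sum_cst => u Au; rewrite -sum_nat_const.
have -> : t = \sum_(v in A) t * (u == v).
  rewrite (bigD1 u) //= eqxx muln1 big1 ?addn0 // => v /andP[_].
  by rewrite eq_sym => /negPf ->; rewrite muln0.
by rewrite -big_split; apply: leq_sum => v Av; apply: le_k.
Qed.

Lemma pair_sum_leq d k A B :
  (forall v, v \in B -> \sum_(u in A) d u v <= k) -> pair_sum d A B <= #|B| * k.
Proof. by move=> le_k; rewrite /pair_sum exchange_big; apply: leq_sum_cst. Qed.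

(** The hypothesis is used for [v] in [D] and for [v] in [F], so that all pairs meeting [D] weigh at
    most 2 on average. *)
Lemma pair_sum_absorb d D F :
  (forall u v, d u v = d v u) -> [disjoint D & F] ->
  (forall v, \sum_(u in D) d u v <= 2 * #|D|) ->
  pair_sum d (D :|: F) (D :|: F) + 2 * #|F| ^ 2
    <= 2 * (#|D| + #|F|) ^ 2 + pair_sum d F F.
Proof.
move=> dC dDF leD; rewrite pair_sum_square //.
have := @pair_sum_leq d _ D D (fun v _ => leD v).
have := @pair_sum_leq d _ D F (fun v _ => leD v).
nia.
Qed.

Lemma sqr_sum_leq Z (f : T -> nat) :
  (\sum_(u in Z) f u) ^ 2 <= #|Z| * \sum_(u in Z) f u ^ 2.
Proof.
rewrite -(leq_pmul2l (isT : 0 < 2)).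
have -> : 2 * (\sum_(u in Z) f u) ^ 2 =
    \sum_(u in Z) \sum_(v in Z) 2 * (f u * f v).
  rewrite -mulnn big_distrlr /= big_distrr; apply: eq_bigr => u _.
  by rewrite big_distrr.
have -> : 2 * (#|Z| * \sum_(u in Z) f u ^ 2) =
    \sum_(u in Z) \sum_(v in Z) (f u ^ 2 + f v ^ 2).
  under [RHS]eq_bigr do rewrite big_split sum_nat_const /=.
  by rewrite big_split sum_nat_const /= -big_distrr /=; lia.
by apply: leq_sum => u _; apply: leq_sum => v _; exact: nat_Cauchy.
Qed.

(** Adjacent vertices have no common neighbour, so their degrees add up to at most [#|Z|]. Summing
    over edges and applying Cauchy-Schwarz gives the bound; [pair_sum e Z Z] counts every edge
    twice. *)
Lemma mantel (e : rel T) Z :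
  symmetric e ->
  {in Z & &, forall u v w, e u v -> e v w -> ~~ e w u} ->
  2 * pair_sum e Z Z <= #|Z| ^ 2.
Proof.
move=> eC tri; pose deg u := \sum_(v in Z) e u v.
have ds : pair_sum e Z Z = \sum_(u in Z) deg u by [].
have deg2 u v : u \in Z -> v \in Z -> e u v -> deg u + deg v <= #|Z|.
  move=> Zu Zv euv; rewrite -big_split -sum1_card; apply: leq_sum => w Zw.
  case euw: (e u w); case evw: (e v w) => //.
  by have := tri u v w Zu Zv Zw euv evw; rewrite eC euw.
have le1 : 2 * \sum_(u in Z) deg u ^ 2 <= #|Z| * pair_sum e Z Z.
  have -> : 2 * \sum_(u in Z) deg u ^ 2 =
      \sum_(u in Z) \sum_(v in Z) e u v * (deg u + deg v).
    have h : \sum_(u in Z) \sum_(v in Z) e u v * deg u = \sum_(u in Z) deg u ^ 2.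
      by apply: eq_bigr => u _; rewrite -mulnn [in RHS]/deg big_distrl.
    have h' : \sum_(u in Z) \sum_(v in Z) e u v * deg v = \sum_(u in Z) deg u ^ 2.
      rewrite exchange_big -h; apply: eq_bigr => u _.
      by apply: eq_bigr => v _; rewrite eC.
    under [RHS]eq_bigr do (under eq_bigr do rewrite mulnDr; rewrite big_split).
    by rewrite big_split /= h h' mul2n addnn.
  rewrite /pair_sum big_distrr; apply: leq_sum => u Zu.
  rewrite big_distrr; apply: leq_sum => v Zv.
  by case euv: (e u v); rewrite /= ?muln0 // muln1 mul1n deg2.
have := sqr_sum_leq Z deg; rewrite -ds.
case: (posnP (pair_sum e Z Z)) => [-> // | s_gt0].
move=> le2; rewrite -(leq_pmul2r s_gt0); nia.
Qed.

Lemma ex_max_nat (U : finType) (P : pred U) (f : U -> nat) x0 :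
  P x0 -> exists2 x, P x & forall y, P y -> f y <= f x.
Proof. by move=> Px0; case: (arg_maxnP f Px0) => x Px max_x; exists x. Qed.

(** A matching is encoded as an involution whose fixed points are the unmatched vertices. One moving
    the most vertices is chosen; composing it with [tperm u v] would match two adjacent fixed
    points. *)
Lemma ex_maximal_matching (h : rel T) Z :
  symmetric h -> irreflexive h ->
  exists mu : T -> T,
    [/\ involutive mu,
        forall u, mu u != u -> (u \in Z) && h u (mu u)
      & {in Z &, forall u v, mu u = u -> mu v = v -> ~~ h u v}].
Proof.
move=> hC hI.
pose P (s : {perm T}) :=
  [forall u, (s (s u) == u) && ((s u != u) ==> (u \in Z) && h u (s u))].
have P1 : P 1%g by apply/forallP => u; rewrite !perm1 !eqxx.
have [s Ps max_s] := ex_max_nat (fun s : {perm T} => #|[set u | s u != u]|) P1.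
have sK u : s (s u) = u by have /forallP/(_ u)/andP[/eqP] := Ps.
have sh u : s u != u -> (u \in Z) && h u (s u).
  by have /forallP/(_ u)/andP[_ /implyP] := Ps.
exists s; split=> // u v Zu Zv su sv; apply/negP => huv.
have neq_uv : u != v by apply: contraTneq huv => ->; rewrite hI.
pose s' := (s * tperm u v)%g.
have s'u : s' u = v by rewrite permM su tpermL.
have s'v : s' v = u by rewrite permM sv tpermR.
have s'w w : w != u -> w != v -> s' w = s w.
  move=> wu wv; rewrite permM tpermD //.
    by apply: contraNneq wu => E; rewrite -(sK w) -E su.
  by apply: contraNneq wv => E; rewrite -(sK w) -E sv.
have /max_s : P s'.
  apply/forallP => w.
  case: (eqVneq w u) => [->|wu]; first by rewrite s'u s'v eqxx Zu huv implybT.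
  case: (eqVneq w v) => [->|wv].
    by rewrite s'v s'u eqxx Zv hC huv implybT.
  rewrite (s'w w) // s'w; first by rewrite sK eqxx; apply/implyP/sh.
    by apply: contraNneq wu => E; rewrite -(sK w) E su.
  by apply: contraNneq wv => E; rewrite -(sK w) E sv.
apply/negP; rewrite -ltnNge; apply: proper_card; apply/properP; split.
  apply/subsetP => w; rewrite !inE => sw; rewrite s'w //.
    by apply: contraNneq sw => ->; rewrite su.
  by apply: contraNneq sw => ->; rewrite sv.
by exists u; rewrite !inE ?s'u ?su ?eqxx // eq_sym.
Qed.

End PairSums.

(** * Maximum covers by typed cycles *)

Lemma digon_freeP l l' :
  (forall j : 'I_3, ~~ (has_others j l && has_others j l')) -> digon_free l l'.
Proof.
move=> H; rewrite /digon_free /=.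
by rewrite (H (@Ordinal 3 0 isT)) (H (@Ordinal 3 1 isT)) (H (@Ordinal 3 2 isT)).
Qed.

Lemma triangle_freeP l1 l2 l3 :
  (forall j : 'I_3, ~~ [&& has_others j l1, has_others j l2 & has_others j l3]) ->
  triangle_free l1 l2 l3.
Proof.
move=> H; rewrite /triangle_free /=.
by rewrite (H (@Ordinal 3 0 isT)) (H (@Ordinal 3 1 isT)) (H (@Ordinal 3 2 isT)).
Qed.

Section Cover.

Variables (T : finType) (L : T -> T -> label).
Hypothesis LI : forall u, L u u = (false, false, false).

(* The nontrivial cycles of [s] are the typed cycles, the fixed points of [s]
   are the uncovered vertices, and [c u] is the type of the cycle of [u]. *)
Definition typed (s : {perm T}) (c : {ffun T -> 'I_3}) : bool :=
  [forall u, (s u != u) ==>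
     (c (s u) == c u) && has_others (c u) (L u (s u))].

Lemma has_others_neq (j : 'I_3) u v : has_others j (L u v) -> u != v.
Proof.
by apply: contraTneq => ->; rewrite LI; case: j => [[|[|[|]]]].
Qed.

(** Labels on the diagonal are empty, so the typed arcs leaving [D] make [s'] move all of [D],
    including [z], which [s] fixes. *)
Lemma typed_extend (s s' : {perm T}) (c c' : {ffun T -> 'I_3}) (D : {set T}) z :
  typed s c -> z \in D -> s z = z ->
  (forall x, x \in D ->
     (c' (s' x) == c' x) && has_others (c' x) (L x (s' x))) ->
  (forall x, x \notin D -> s' x = s x) ->
  (forall x, s x != x -> c' x = c x) ->
  typed s' c' /\ #|[set x | s x != x]| < #|[set x | s' x != x]|.
Proof.
move=> /forallP ts Dz sz HD HnD Hc; split.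
  apply/forallP => x; apply/implyP; have [Dx _ | nDx] := boolP (x \in D).
    exact: HD.
  rewrite HnD // => sx; rewrite !Hc ?(inj_eq perm_inj) //.
  exact: (implyP (ts x)).
have mvD x : x \in D -> s' x != x.
  by move=> /HD/andP[_ /has_others_neq]; rewrite eq_sym.
apply/proper_card/properP; split.
  apply/subsetP => x; rewrite !inE => sx.
  by have [/mvD // | /HnD ->] := boolP (x \in D).
by exists z; rewrite !inE ?mvD // sz eqxx.
Qed.

Lemma ex_maximal_cover : exists (s : {perm T}) (c : T -> 'I_3),
  [/\ forall u, s u != u -> c (s u) = c u /\ has_others (c u) (L u (s u)),
      forall u z, s u != u -> s z = z ->
        ~~ (has_others (c u) (L u z) && has_others (c u) (L z (s u))),
      forall u v, s u = u -> s v = v -> digon_free (L u v) (L v u)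
    & forall u v w, s u = u -> s v = v -> s w = w ->
        triangle_free (L u v) (L v w) (L w u)].
Proof.
have t1 : typed 1%g [ffun=> ord0].
  by apply/forallP => u; rewrite perm1 eqxx.
have [[s c] ts max_s] := ex_max_nat
  (P := fun p : {perm T} * {ffun T -> 'I_3} => typed p.1 p.2)
  (fun p => #|[set u | p.1 u != u]|) (x0 := (1%g, _)) t1.
have no_ext (s' : {perm T}) (c' : {ffun T -> 'I_3}) (D : {set T}) z :
    z \in D -> s z = z ->
    (forall x, x \in D ->
      (c' (s' x) == c' x) && has_others (c' x) (L x (s' x))) ->
    (forall x, x \notin D -> s' x = s x) ->
    (forall x, s x != x -> c' x = c x) -> False.
  move=> Dz sz H1 H2 H3.
  have [ts' lt_s] := typed_extend ts Dz sz H1 H2 H3.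
  by have := max_s (s', c') ts'; rewrite leqNgt lt_s.
have fix_neq x y : x != y -> s y = y -> y != s x.
  by move=> xy sy; rewrite -[X in X != _]sy (inj_eq perm_inj) eq_sym.
exists s, c; split=> [u su | u z su sz | u v su sv | u v w su sv sw].
- by have /forallP/(_ u) := ts; rewrite su /= => /andP[/eqP].
- apply/negP => /andP[huz hzu].
  have uz : u != z by apply: contraNneq su => ->; rewrite sz.
  (* Inserts [z] between [u] and [s u]. *)
  pose s' := (s * tperm z (s u))%g.
  have s'u : s' u = z by rewrite permM tpermR.
  have s'z : s' z = s u by rewrite permM sz tpermL.
  apply: (no_ext s' [ffun x => if x == z then c u else c x] [set u; z] z) => //.
  + by rewrite !inE eqxx orbT.
  + have suz : s u != z by rewrite -sz (inj_eq perm_inj).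
    have /forallP/(_ u) := ts; rewrite su /= => /andP[/eqP csu _].
    move=> x; rewrite !inE => /orP[] /eqP ->.
      by rewrite s'u !ffunE eqxx (negPf uz) huz eqxx.
    by rewrite s'z !ffunE eqxx (negPf suz) csu hzu eqxx.
  + move=> x; rewrite !inE negb_or => /andP[xu xz].
    by rewrite permM tpermD // 1?eq_sym ?(inj_eq perm_inj) // -sz (inj_eq perm_inj).
  + by move=> x sx; rewrite ffunE; case: (eqVneq x z) sx => // ->; rewrite sz eqxx.
- apply: digon_freeP => j; apply/negP => /andP[huv hvu].
  pose s' := (s * tperm u v)%g.
  have s'u : s' u = v by rewrite permM su tpermL.
  have s'v : s' v = u by rewrite permM sv tpermR.
  apply: (no_ext s' [ffun x => if s x == x then j else c x] [set u; v] u) => //.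
  + by rewrite !inE eqxx.
  + move=> x; rewrite !inE => /orP[] /eqP ->.
      by rewrite s'u !ffunE su sv !eqxx.
    by rewrite s'v !ffunE su sv !eqxx.
  + move=> x; rewrite !inE negb_or => /andP[xu xv].
    by rewrite permM tpermD ?fix_neq.
  + by move=> x sx; rewrite ffunE (negPf sx).
- apply: triangle_freeP => j; apply/negP => /and3P[huv hvw hwu].
  have uv := has_others_neq huv; have vw := has_others_neq hvw.
  have wu := has_others_neq hwu.
  have wv : w != v by rewrite eq_sym.
  have uw : u != w by rewrite eq_sym.
  (* Adds the cycle [u -> v -> w -> u]; products of permutations apply the left factor first. *)
  pose s' := (s * (tperm u v * tperm u w))%g.
  have s'u : s' u = v by rewrite !permM su tpermL tpermD.
  have s'v : s' v = w by rewrite !permM sv tpermR tpermL.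
  have s'w : s' w = u by rewrite !permM sw (tpermD uw vw) tpermR.
  apply: (no_ext s' [ffun x => if s x == x then j else c x] [set u; v; w] u) => //.
  + by rewrite !inE eqxx.
  + move=> x; rewrite !inE => /orP[/orP[]|] /eqP ->.
    * by rewrite s'u !ffunE su sv !eqxx.
    * by rewrite s'v !ffunE sw sv !eqxx.
    * by rewrite s'w !ffunE su sw !eqxx.
  + move=> x; rewrite !inE !negb_or => /andP[/andP[xu xv] xw].
    by rewrite !permM !tpermD ?fix_neq.
  + by move=> x sx; rewrite ffunE (negPf sx).
Qed.

End Cover.

(** * Uncovered vertices *)

Lemma ncol_but_pair (i j k : 'I_3) l :
  uniq [:: i; j; k] -> ncol_but i l + ncol_but j l = ncol l + has_colour k l.
Proof.
by case: i j k l => [[|[|[|]]]] // ? [[|[|[|]]]] // ? [[|[|[|]]]] // ? [[[] []] []].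
Qed.

Lemma ncol_leq l : ncol l <= 3.
Proof. by case: l => [[[] []] []]. Qed.

Lemma ncol_but_leq (j : 'I_3) l : ncol_but j l <= 2.
Proof. by case: j l => [[|[|[|]]]] // ? [[[] []] []]. Qed.

Section Uncovered.

Variables (T : finType) (L : T -> T -> label).
Hypothesis LI : forall u, L u u = (false, false, false).
Hypothesis nr : forall u v w, not_rainbow (L u v) (L v w) (L w u).

Definition mult u v := ncol (L u v) + ncol (L v u).
Definition mult_but j u v := ncol_but j (L u v) + ncol_but j (L v u).

Lemma multC u v : mult u v = mult v u.
Proof. exact: addnC. Qed.

Lemma mult_butC j u v : mult_but j u v = mult_but j v u.
Proof. exact: addnC. Qed.

Lemma mult_diag u : mult u u = 0.
Proof. by rewrite /mult LI. Qed.

Lemma mult_but_diag (j : 'I_3) u : mult_but j u u = 0.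
Proof. by rewrite /mult_but LI; case: j => [[|[|[|]]]]. Qed.

Variable Z : {set T}.
Hypothesis dfree : {in Z &, forall u v, digon_free (L u v) (L v u)}.
Hypothesis tfree : {in Z & &, forall u v w,
  triangle_free (L u v) (L v w) (L w u)}.

Lemma admissible_uncovered u v w : u \in Z -> v \in Z -> w \in Z ->
  admissible (L u v) (L v u) (L v w) (L w v) (L w u) (L u w).
Proof.
by move=> Zu Zv Zw; rewrite /admissible !dfree // !nr !tfree.
Qed.

Lemma mult_but_uncovered (j : 'I_3) :
  pair_sum (mult_but j) Z Z <= 3 * #|Z| ^ 2.
Proof.
have := @pair_sum_diag T (mult_but j) 3 0 Z.
rewrite mul0n addn0; apply=> u v Zu Zv; rewrite mul0n addn0.
exact: digon_free_ncol_but (dfree Zu Zv).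
Qed.

(** The two multiplicities add up to [mult u v] plus the number of directions carrying [k]. This is
    at most 5, except for 6 on heavy pairs with [k] both ways; by Mantel these are at most half of
    the ordered pairs, whence 5 + 1/2. *)
Lemma mult_but_pair_uncovered (i j k : 'I_3) : uniq [:: i; j; k] ->
  2 * (pair_sum (mult_but i) Z Z + pair_sum (mult_but j) Z Z) <= 11 * #|Z| ^ 2.
Proof.
move=> ijk; pose e u v := heavy_digon k (L u v) (L v u).
have eC : symmetric e.
  by move=> u v; rewrite /e /heavy_digon /heavy addnC [X in _ && X]andbC.
have := @mantel _ e Z eC.
have -> : pair_sum (mult_but i) Z Z + pair_sum (mult_but j) Z Z =
    pair_sum (fun u v => mult_but i u v + mult_but j u v) Z Z.
  by rewrite -big_split; apply: eq_bigr => u _; rewrite -big_split.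
have : pair_sum (fun u v => mult_but i u v + mult_but j u v) Z Z <=
    pair_sum e Z Z + 5 * #|Z| ^ 2.
  have -> : 5 * #|Z| ^ 2 = \sum_(u in Z) \sum_(v in Z) 5.
    by rewrite !sum_nat_const; lia.
  rewrite -big_split; apply: leq_sum => u Zu; rewrite -big_split.
  apply: leq_sum => v Zv /=.
  rewrite /mult_but addnACA !(ncol_but_pair _ ijk).
  have := digon_free_ncol (dfree Zu Zv); rewrite /e /heavy_digon /heavy.
  by case: (has_colour _ _); case: (has_colour _ _); case: eqP; lia.
move=> le1 le2; suff: 2 * pair_sum e Z Z <= #|Z| ^ 2 by lia.
apply: le2 => u v w Zu Zv Zw euv evw; apply/negP => ewu.
have /negP := heavy_digon_triangle_free euv evw ewu.
by apply; apply: admissible_uncovered.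
Qed.

Notation heavyL u v := (heavy (L u v) (L v u)).

Lemma heavy_two u v z : u \in Z -> v \in Z -> z \in Z -> heavyL u v ->
  [&& mult z u + mult z v <= 7,
      (ncol (L u v) == 2) ==> (mult z u + mult z v <= 6)
    & (ncol (L u v) == 3) && (mult z u + mult z v == 7) ==>
       [&& ncol (L v z) == 3, ncol (L u z) == 3 & ncol (L z v) == 1]
    || [&& ncol (L z u) == 3, ncol (L z v) == 3 & ncol (L u z) == 1]].
Proof.
move=> Zu Zv Zz hv.
have -> : mult z u + mult z v =
    ncol (L v z) + ncol (L z v) + ncol (L z u) + ncol (L u z).
  by rewrite /mult; lia.
exact: heavy_sum hv (admissible_uncovered Zu Zv Zz).
Qed.

(** A total of 14 puts both [u'] and [v'] in the equality case of [heavy_two]. In each of the four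
    combinations two consecutive full arcs appear, so the closing arc is empty by [full_ncol],
    although the equality case or the heaviness of the pair puts a colour on it. *)
Lemma heavy_two_full u v u' v' :
  [/\ u \in Z, v \in Z, u' \in Z & v' \in Z] ->
  heavyL u v -> heavyL u' v' -> ncol (L u v) = 3 -> ncol (L u' v') = 3 ->
  mult u' u + mult u' v + mult v' u + mult v' v <= 13.
Proof.
move=> [Zu Zv Zu' Zv'] h h' f f'.
have /and3P[le1 _ P1] := heavy_two Zu Zv Zu' h.
have /and3P[le2 _ P2] := heavy_two Zu Zv Zv' h.
rewrite leqNgt; apply/negP => gt13.
have e1 : mult u' u + mult u' v == 7 by lia.
have e2 : mult v' u + mult v' v == 7 by lia.
have full x y z : ncol (L x y) == 3 -> ncol (L y z) == 3 -> ncol (L z x) = 0.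
  by move=> /eqP xy /eqP yz; apply: full_ncol (nr x y z) xy yz.
move: P1 P2; rewrite f e1 e2 /=.
move=> /orP[] /and3P[p1 p2 p3] /orP[] /and3P[q1 q2 q3].
- by have := full v u' v' p1 (introT eqP f'); rewrite (eqP q3).
- by have := full v u' v' p1 (introT eqP f'); rewrite (eqP q2).
- by have := full u' u v' p1 q2; move: h'; rewrite /heavy f' => /eqP; lia.
- by have := full u' v' u (introT eqP f') q1; rewrite (eqP p3).
Qed.

(** If one pair splits as 2 + 2, each vertex of the other sends it at most 6. Otherwise both pairs
    contain a full arc, and renaming ends reduces to [heavy_two_full]. *)
Lemma heavy_four u v u' v' :
  [/\ u \in Z, v \in Z, u' \in Z & v' \in Z] ->
  heavyL u v -> heavyL u' v' ->
  mult u' u + mult u' v + mult v' u + mult v' v <= 13.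
Proof.
move=> [Zu Zv Zu' Zv'] h h'.
have hC x y : heavyL x y -> heavyL y x by rewrite /heavy addnC.
have split_heavy x y : heavyL x y ->
    [\/ ncol (L x y) = 2, ncol (L x y) = 3 | ncol (L y x) = 3].
  rewrite /heavy => hxy; have := ncol_leq (L x y); have := ncol_leq (L y x).
  move=> le1 le2; suff /or3P[/eqP|/eqP|/eqP] : [|| ncol (L x y) == 2,
    ncol (L x y) == 3 | ncol (L y x) == 3] by [constructor 1|constructor 2|constructor 3].
  by lia.
case: (split_heavy _ _ h) => [two|f|f].
- have /and3P[_ + _] := heavy_two Zu Zv Zu' h.
  have /and3P[_ + _] := heavy_two Zu Zv Zv' h.
  by rewrite two /=; lia.
all: case: (split_heavy _ _ h') => [two|f'|f'].
all: try by have /and3P[_ + _] := heavy_two Zu' Zv' Zu h';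
  have /and3P[_ + _] := heavy_two Zu' Zv' Zv h';
  rewrite two /= !(multC u) !(multC v); lia.
- exact: heavy_two_full.
- by have := @heavy_two_full u v v' u' (And4 Zu Zv Zv' Zu') h (hC _ _ h') f f'; lia.
- by have := @heavy_two_full v u u' v' (And4 Zv Zu Zu' Zv') (hC _ _ h) h' f f'; lia.
- have := @heavy_two_full v u v' u' (And4 Zv Zu Zv' Zu') (hC _ _ h) (hC _ _ h') f f'.
  by lia.
Qed.

(** A maximal matching of heavy pairs splits [Z] into matched [M] and unmatched [W]. Average
    multiplicities are at most 13/4 inside [M], 7/2 between [W] and [M], and 3 inside [W], where
    maximality excludes heavy pairs. *)
Lemma mult_uncovered : 3 * pair_sum mult Z Z + 3 * #|Z| <= 10 * #|Z| ^ 2.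
Proof.
have hC : symmetric (fun u v => heavyL u v).
  by move=> u v; rewrite /heavy addnC.
have hI : irreflexive (fun u v => heavyL u v) by move=> u; rewrite /= LI.
have [mu [muK muh mumax]] := ex_maximal_matching Z hC hI.
pose M := [set u | mu u != u]; pose W := Z :\: M.
have MZ u : u \in M -> u \in Z by rewrite inE => /muh/andP[].
have Mh u : u \in M -> heavyL u (mu u) by rewrite inE => /muh/andP[].
have Mmu u : (mu u \in M) = (u \in M) by rewrite !inE muK eq_sym.
have muM u : u \in M -> mu u \in M by rewrite Mmu.
have sumM f : \sum_(u in M) f (mu u) = \sum_(u in M) f u.
  rewrite [RHS](reindex_inj (inv_inj muK)).
  by apply: eq_bigl => u; rewrite Mmu.
have ZE : Z = W :|: M.
  apply/setP => u; rewrite !inE; case: eqP => [_ | /eqP muu] /=.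
    by rewrite orbF.
  by have /muh/andP[-> _] := muu.
have dWM : [disjoint W & M] by rewrite -setI_eq0 /W setDE -setIA (setIC _ M) setICr setI0.
have WZ u : u \in W -> u \in Z by rewrite inE => /andP[].
have multMM : 4 * pair_sum mult M M + 5 * #|M| <= 13 * #|M| ^ 2.
  (* For [u = v] the four terms are 0, 4, 4, 0, which is 5 below the bound 13 of [heavy_four]. *)
  pose q u v := mult u v + mult u (mu v) + mult (mu u) v + mult (mu u) (mu v).
  have -> : 4 * pair_sum mult M M = pair_sum q M M.
    have e1 : pair_sum (fun u v => mult u (mu v)) M M = pair_sum mult M M.
      by apply: eq_bigr => u _; rewrite sumM.
    have e2 : pair_sum (fun u v => mult (mu u) v) M M = pair_sum mult M M.
      exact: (sumM (fun u => \sum_(v in M) mult u v)).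
    have e3 : pair_sum (fun u v => mult (mu u) (mu v)) M M = pair_sum mult M M.
      by rewrite -e1; exact: (sumM (fun u => \sum_(v in M) mult u (mu v))).
    transitivity (pair_sum mult M M + pair_sum (fun u v => mult u (mu v)) M M +
        pair_sum (fun u v => mult (mu u) v) M M +
        pair_sum (fun u v => mult (mu u) (mu v)) M M).
      by rewrite e1 e2 e3; lia.
    by rewrite /pair_sum -!big_split; apply: eq_bigr => u _; rewrite -!big_split.
  apply: pair_sum_diag => u v Mu Mv.
  have [<- | _] := eqVneq u v; last first.
    by rewrite muln0 addn0; apply: heavy_four; rewrite ?Mh //; split; rewrite MZ ?muM.
  have := Mh u Mu; rewrite /heavy -/(mult u (mu u)) /q !mult_diag.
  by rewrite (multC (mu u)) => /eqP ->.
have multWM : 2 * pair_sum mult W M <= 7 * (#|W| * #|M|).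
  rewrite [_ * pair_sum _ _ _]big_distrr mulnCA; apply: leq_sum_cst => z Wz /=.
  have -> : 2 * \sum_(v in M) mult z v = \sum_(v in M) (mult z v + mult z (mu v)).
    by rewrite [RHS]big_split /= sumM mul2n addnn.
  rewrite mulnC; apply: leq_sum_cst => u Mu.
  by have /and3P[] := heavy_two (MZ _ Mu) (MZ _ (muM _ Mu)) (WZ _ Wz) (Mh _ Mu).
have multWW : pair_sum mult W W + 3 * #|W| <= 3 * #|W| ^ 2.
  apply: pair_sum_diag => u v Wu Wv.
  have [<- | _] := eqVneq u v; first by rewrite mult_diag.
  have := digon_free_ncol (dfree (WZ _ Wu) (WZ _ Wv)); rewrite -/(mult u v).
  have := mumax u v (WZ _ Wu) (WZ _ Wv).
  have muW w : w \in W -> mu w = w by rewrite !inE negbK => /andP[/eqP].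
  by rewrite !muW // => /(_ erefl erefl); rewrite /heavy -/(mult u v); lia.
have cZ : #|Z| = #|W| + #|M| by rewrite ZE cardsU disjoint_setI0 // cards0 subn0.
rewrite cZ {1 2}ZE pair_sum_square //; last exact: multC.
move: multMM multWM multWW.
move: (pair_sum _ _ _) (pair_sum _ _ _) (pair_sum _ _ _) #|M| #|W| => c b a x y.
(* Up to linear terms, the slack is [(x - 2 * y) ^ 2 / 4]. *)
have [+ _] := nat_Cauchy x (2 * y); lia.
Qed.

End Uncovered.

(** * Sums over the covered vertices *)

Section CoverSums.

Variables (T : finType) (L : T -> T -> label).
Hypothesis LI : forall u, L u u = (false, false, false).
Hypothesis nr : forall u v w, not_rainbow (L u v) (L v w) (L w u).
Variables (s : {perm T}) (c : T -> 'I_3).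
Hypothesis typed_s :
  forall u, s u != u -> c (s u) = c u /\ has_others (c u) (L u (s u)).
Hypothesis no_insertion : forall u z, s u != u -> s z = z ->
  ~~ (has_others (c u) (L u z) && has_others (c u) (L z (s u))).

Definition moved := [set u | s u != u].
Definition uncovered := [set u | s u == u].
Definition moved_typed j := [set u | (s u != u) && (c u == j)].
Definition moved_untyped j := [set u | (s u != u) && (c u != j)].

Lemma sum_shift (A : {set T}) (f : T -> nat) :
  (forall u, (s u \in A) = (u \in A)) ->
  \sum_(u in A) f (s u) = \sum_(u in A) f u.
Proof.
move=> sA; rewrite [RHS](reindex_inj (@perm_inj _ s)).
by apply: eq_bigl => u; rewrite sA.
Qed.

Lemma in_moved_shift u : (s u \in moved) = (u \in moved).
Proof. by rewrite !inE (inj_eq perm_inj). Qed.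

Lemma in_moved_typed_shift j u :
  (s u \in moved_typed j) = (u \in moved_typed j).
Proof.
rewrite !inE (inj_eq perm_inj); case: eqVneq => //= su.
by have [-> _] := typed_s su.
Qed.

Lemma in_moved_untyped_shift j u :
  (s u \in moved_untyped j) = (u \in moved_untyped j).
Proof.
rewrite !inE (inj_eq perm_inj); case: eqVneq => //= su.
by have [-> _] := typed_s su.
Qed.

(** Shifting one summand along [s] pairs the arcs [s u -> v] and [v -> u]. As the type of [u] is not
    [j], the arc [u -> s u] carries [j], and [bracket] applies. *)
Lemma sum_untyped j v :
  \sum_(u in moved_untyped j) mult_but L j u v <= 2 * #|moved_untyped j|.
Proof.
rewrite big_split -(sum_shift (fun u => ncol_but j (L u v))) /=; last first.
  exact: in_moved_untyped_shift.
rewrite -big_split mulnC; apply: leq_sum_cst => u.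
rewrite inE => /andP[su cuj]; have [_ hu] := typed_s su.
exact: bracket (nr u (s u) v) (has_others_colour cuj hu).
Qed.

(** Shifting along [s] pairs [u -> z] with [z -> s u]; if both had the type of [u], then [z] could
    be inserted after [u]. *)
Lemma sum_others_leq (A : {set T}) z :
  (forall u, (s u \in A) = (u \in A)) -> A \subset moved -> z \in uncovered ->
  \sum_(u in A) (has_others (c u) (L (s u) z) + has_others (c u) (L z u))
    <= #|A|.
Proof.
move=> sA /subsetP Am; rewrite inE => /eqP sz.
have mv u : u \in A -> s u != u by move/Am; rewrite inE.
have -> : \sum_(u in A) (has_others (c u) (L (s u) z) + has_others (c u) (L z u))
    = \sum_(u in A) (has_others (c u) (L u z) + has_others (c u) (L z (s u))).
  rewrite !big_split /= -(sum_shift (fun u => has_others (c u) (L u z) : nat) sA).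
  rewrite -(sum_shift (fun u => has_others (c u) (L z u) : nat) sA).
  by congr (_ + _); apply: eq_bigr => u /mv/typed_s[-> _].
rewrite -[#|A|]muln1; apply: leq_sum_cst => u /mv su.
by have := no_insertion su sz; do 2!case: has_others.
Qed.

Lemma sum_typed_uncovered j z : z \in uncovered ->
  \sum_(u in moved_typed j) mult_but L j u z <= 3 * #|moved_typed j|.
Proof.
move=> Zz; have sA := in_moved_typed_shift j.
have /(sum_others_leq sA)/(_ Zz) le1 : moved_typed j \subset moved.
  by apply/subsetP => u; rewrite !inE => /andP[].
rewrite big_split -(sum_shift (fun u => ncol_but j (L u z)) sA) /= -big_split.
rewrite (_ : 3 * _ = #|moved_typed j| * 2 + #|moved_typed j|); last lia.
apply: leq_trans (leq_add (leqnn _) le1).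
rewrite -sum_nat_const -big_split; apply: leq_sum => u /=.
rewrite inE => /andP[_ /eqP ->].
have := ncol_but_typed j (L (s u) z); have := ncol_but_typed j (L z u); lia.
Qed.

Lemma sum_moved_uncovered z : z \in uncovered ->
  \sum_(u in moved) mult L u z <= 3 * #|moved|.
Proof.
move=> Zz; have le1 := sum_others_leq in_moved_shift (subxx _) Zz.
rewrite big_split -(sum_shift (fun u => ncol (L u z)) in_moved_shift) /= -big_split.
rewrite (_ : 3 * _ = #|moved| * 2 + #|moved|); last lia.
apply: leq_trans (leq_add (leqnn _) le1).
rewrite -sum_nat_const -big_split; apply: leq_sum => u /=.
rewrite inE => su; have [_ hu] := typed_s su.
have := typed_ncol (nr u (s u) z) hu; lia.
Qed.

Lemma moved_typedE j : moved = moved_untyped j :|: moved_typed j.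
Proof. by apply/setP => u; rewrite !inE -andb_orr orNb andbT. Qed.

Lemma disjoint_typed j : [disjoint moved_untyped j & moved_typed j].
Proof.
rewrite -setI_eq0; apply/eqP/setP => u; rewrite !inE.
by do 2!case: eqP.
Qed.

Lemma card_moved j : #|moved| = #|moved_untyped j| + #|moved_typed j|.
Proof.
by rewrite (moved_typedE j) cardsU disjoint_setI0 ?disjoint_typed // cards0 subn0.
Qed.

Lemma setT_moved : [set: T] = moved :|: uncovered.
Proof. by apply/setP => u; rewrite !inE orNb. Qed.

Lemma disjoint_moved : [disjoint moved & uncovered].
Proof. by rewrite -setI_eq0; apply/eqP/setP => u; rewrite !inE; case: eqP. Qed.

Lemma card_covered : #|T| = #|moved| + #|uncovered|.
Proof.
by rewrite -cardsT setT_moved cardsU disjoint_setI0 ?disjoint_moved // cards0 subn0.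
Qed.

Lemma sum_card_typed : \sum_(j < 3) #|moved_typed j| = #|moved|.
Proof.
rewrite -sum1_card (partition_big c predT) //=; apply: eq_bigr => j _.
by rewrite -sum1_card; apply: eq_bigl => u; rewrite !inE.
Qed.

Lemma pair_sum_typed (j : 'I_3) :
  pair_sum (mult_but L j) (moved_typed j) (moved_typed j) + 4 * #|moved_typed j|
    <= 4 * #|moved_typed j| ^ 2.
Proof.
apply: pair_sum_diag => u v _ _; have [<- | _] := eqVneq u v.
  by rewrite mult_but_diag.
by rewrite /mult_but muln0 addn0 (leq_add (ncol_but_leq _ _) (ncol_but_leq _ _)).
Qed.

(** The cycles of types other than [j] are absorbed. Among the rest, pairs inside [moved_typed j]
    weigh at most 4 and those joining it to [uncovered] at most 3 on average. *)
Lemma pair_sum_all (j : 'I_3) :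
  pair_sum (mult_but L j) setT setT + 2 * #|uncovered| ^ 2 <=
    2 * #|T| ^ 2 + 2 * #|moved_typed j| ^ 2
      + 2 * #|moved_typed j| * #|uncovered|
      + pair_sum (mult_but L j) uncovered uncovered.
Proof.
pose F := moved_typed j :|: uncovered.
have dF : [disjoint moved_typed j & uncovered].
  by rewrite -setI_eq0; apply/eqP/setP => u; rewrite !inE; case: eqP; rewrite ?andbF.
have dD : [disjoint moved_untyped j & F].
  rewrite -setI_eq0; apply/eqP/setP => u; rewrite !inE.
  by case: (s u == u); case: (c u == j).
have TE : setT = moved_untyped j :|: F by rewrite setUA -moved_typedE setT_moved.
have := pair_sum_absorb (mult_butC L j) dD (sum_untyped j).
rewrite -TE (pair_sum_square (mult_butC L j) dF).
have -> : #|F| = #|moved_typed j| + #|uncovered|.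
  by rewrite cardsU disjoint_setI0 // cards0 subn0.
have := pair_sum_leq (@sum_typed_uncovered j).
have := pair_sum_typed j; have := card_moved j; have := card_covered.
move: (pair_sum _ _ _) (pair_sum _ _ _) (pair_sum _ _ _) (pair_sum _ _ _).
move=> a b e f -> ->; nia.
Qed.

Lemma sum_mult_but A B :
  \sum_(j < 3) pair_sum (mult_but L j) A B = 2 * pair_sum (mult L) A B.
Proof.
rewrite /pair_sum exchange_big big_distrr; apply: eq_bigr => u _.
rewrite exchange_big big_distrr; apply: eq_bigr => v _.
rewrite !big_ord_recl big_ord0 /mult_but /mult /=.
by case: (L u v) (L v u) => [[[] []] []] [[[] []] []].
Qed.

(** Pairs of moved vertices are treated colour by colour, but mixed pairs through [mult] at once:
    this saves [2 * #|moved| * #|uncovered|] over adding up [pair_sum_all]. *)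
Lemma pair_sum_total :
  \sum_(j < 3) pair_sum (mult_but L j) setT setT + 4 * #|moved| <=
    6 * #|moved| ^ 2 + 2 * \sum_(j < 3) #|moved_typed j| ^ 2
      + 12 * #|moved| * #|uncovered| + 2 * pair_sum (mult L) uncovered uncovered.
Proof.
rewrite sum_mult_but setT_moved (pair_sum_square (multC L) disjoint_moved).
have := pair_sum_leq sum_moved_uncovered.
suff : 2 * pair_sum (mult L) moved moved + 4 * #|moved| <=
    6 * #|moved| ^ 2 + 2 * \sum_(j < 3) #|moved_typed j| ^ 2 by nia.
rewrite -sum_mult_but -{1}sum_card_typed !big_distrr -!big_split /=.
have -> : 6 * #|moved| ^ 2 = \sum_(j < 3) 2 * #|moved| ^ 2.
  by rewrite sum_nat_const card_ord; lia.
rewrite -!big_split; apply: leq_sum => j _ /=.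
have := pair_sum_absorb (mult_butC L j) (disjoint_typed j) (sum_untyped j).
rewrite -moved_typedE -card_moved; have := pair_sum_typed j; lia.
Qed.

End CoverSums.

Lemma leq_third n r x y z : n = x + y + z + r ->
  2 * n ^ 2 <= 18 * y ^ 2 + 18 * (y * r) + 9 * r ^ 2 ->
  2 * n ^ 2 <= 18 * z ^ 2 + 18 * (z * r) + 9 * r ^ 2 ->
  8 * n ^ 2 <= 36 * (y ^ 2 + z ^ 2) + 36 * r * (y + z) + 27 * r ^ 2 ->
  3 * x <= n + r.
Proof.
move=> nE by_ bz c; rewrite leqNgt; apply/negP => gt_x.
have lt_yz : 3 * (y + z) + 4 * r < 2 * n by lia.
(* If [6 * t + 4 * r < 2 * n], the right side of a one-colour bound is at most
   [2 * n ^ 2 - r * (2 * n - 5 * r)], whence the threshold. Beyond it, [2 * n / 5 < r < n / 2] and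
   the two-colour bound fails, using [y ^ 2 + z ^ 2 <= (y + z) ^ 2]. *)
have [le_r | gt_r] := leqP (5 * r) (2 * n).
  have half t : 2 * n ^ 2 <= 18 * t ^ 2 + 18 * (t * r) + 9 * r ^ 2 ->
      2 * n <= 6 * t + 4 * r.
    move=> bt; rewrite leqNgt; apply/negP => lt_t; nia.
  by have := half y by_; have := half z bz; lia.
nia.
Qed.

(** * The final contradiction *)

Lemma rainbow_colours l1 l2 l3 : ~~ not_rainbow l1 l2 l3 ->
  exists a b d : 'I_3, [/\ uniq [:: a; b; d], has_colour a l1,
    has_colour b l2 & has_colour d l3].
Proof.
have lt3 a : a \in [:: 0; 1; 2] -> a < 3 by case: a => [|[|[|]]].
case/allPn=> a /lt3 a3 /allPn[b /lt3 b3] /allPn[d /lt3 d3].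
rewrite negb_imply negbK => /andP[abd /and3P[ha hb hd]].
by exists (Ordinal a3), (Ordinal b3), (Ordinal d3).
Qed.

Lemma other_colours (j : 'I_3) : exists i k : 'I_3, uniq [:: i; j; k].
Proof.
case: j => [[|[|[|//]]] lt_j].
- by exists (@Ordinal 3 1 isT), (@Ordinal 3 2 isT).
- by exists (@Ordinal 3 0 isT), (@Ordinal 3 2 isT).
- by exists (@Ordinal 3 0 isT), (@Ordinal 3 1 isT).
Qed.

Lemma ncol_but_others (i j k : 'I_3) l :
  uniq [:: i; j; k] -> ncol_but j l = has_colour i l + has_colour k l.
Proof.
by case: i j k l => [[|[|[|]]]] // ? [[|[|[|]]]] // ? [[|[|[|]]]] // ? [[[] []] []].
Qed.

Lemma dense_rainbow (T : finType) (L : T -> T -> label) :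
  0 < #|T| -> (forall u, L u u = (false, false, false)) ->
  (forall j : 'I_3, 20 * #|T| ^ 2 <= 9 * pair_sum (mult_but L j) setT setT) ->
  exists u v w, ~~ not_rainbow (L u v) (L v w) (L w u).
Proof.
move=> T_gt0 LI dense.
have [/existsP[[[u v] w] nr] | /existsPn nr'] := boolP [exists p : T * T * T,
    ~~ not_rainbow (L p.1.1 p.1.2) (L p.1.2 p.2) (L p.2 p.1.1)].
  by exists u, v, w.
have {nr'} nr u v w : not_rainbow (L u v) (L v w) (L w u).
  by have := nr' (u, v, w); rewrite negbK.
exfalso; have [s [c [ts no_ins dfree tfree]]] := ex_maximal_cover LI.
pose Z := uncovered s; pose x j := #|moved_typed s c j|.
have ZP u : u \in Z -> s u = u by rewrite inE => /eqP.
have dZ : {in Z &, forall u v, digon_free (L u v) (L v u)}.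
  by move=> u v /ZP su /ZP sv; apply: dfree.
have tZ : {in Z & &, forall u v w, triangle_free (L u v) (L v w) (L w u)}.
  by move=> u v w /ZP su /ZP sv /ZP sw; apply: tfree.
have upper j := pair_sum_all LI nr ts no_ins j.
have one j : 2 * #|T| ^ 2 <= 18 * x j ^ 2 + 18 * (x j * #|Z|) + 9 * #|Z| ^ 2.
  by have := dense j; have := upper j; have := mult_but_uncovered dZ j;
    rewrite -/Z -/(x j); nia.
have two i j k : uniq [:: i; j; k] ->
    8 * #|T| ^ 2 <= 36 * (x i ^ 2 + x j ^ 2) + 36 * #|Z| * (x i + x j)
      + 27 * #|Z| ^ 2.
  move=> ijk; have := mult_but_pair_uncovered nr dZ tZ ijk.
  by have := dense i; have := dense j; have := upper i; have := upper j;
    rewrite -/Z -/(x i) -/(x j); nia.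
have total := pair_sum_total LI nr ts no_ins.
have uncov := mult_uncovered LI nr dZ tZ.
have cardT := card_covered s; have cardM := sum_card_typed s c.
have small i j k : uniq [:: i; j; k] -> #|T| = x k + x i + x j + #|Z| ->
    3 * x k <= #|T| + #|Z|.
  by move=> ijk cT; apply: leq_third cT (one i) (one j) (two i j k ijk).
pose c0 : 'I_3 := @Ordinal 3 0 isT; pose c1 : 'I_3 := @Ordinal 3 1 isT.
pose c2 : 'I_3 := @Ordinal 3 2 isT.
have sum3 f : \sum_(j < 3) f j = f c0 + f c1 + f c2 :> nat.
  rewrite !big_ord_recl big_ord0 addn0 addnA.
  by congr (f _ + f _ + f _); apply: val_inj.
move: total uncov cardT cardM; rewrite !sum3 -/Z -!/(x _) => total uncov cardT cardM.
have cT : #|T| = x c0 + x c1 + x c2 + #|Z| by lia.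
have s0 : 3 * x c0 <= #|T| + #|Z| by apply: (small c1 c2 c0) => //; lia.
have s1 : 3 * x c1 <= #|T| + #|Z| by apply: (small c0 c2 c1) => //; lia.
have s2 : 3 * x c2 <= #|T| + #|Z| by apply: (small c0 c1 c2) => //; lia.
have {dense} : 60 * #|T| ^ 2 <= 9 * (pair_sum (mult_but L c0) setT setT +
    pair_sum (mult_but L c1) setT setT + pair_sum (mult_but L c2) setT setT).
  by have := dense c0; have := dense c1; have := dense c2; lia.
move: total uncov cT cardT cardM s0 s1 s2 T_gt0; clear.
move: (pair_sum (mult L) Z Z) (_ + _ + pair_sum _ _ _) #|moved s| #|T| #|Z|.
move: (x c0) (x c1) (x c2) => y0 y1 y2 q P m t r total uncov cT cardT cardM.
move=> s0 s1 s2 t_gt0 low.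
have sqr_leq y : 3 * y <= t + r -> 3 * y ^ 2 <= y * (t + r).
  by move=> le_y; rewrite -mulnn mulnCA leq_mul2l le_y orbT.
move: (sqr_leq _ s0) (sqr_leq _ s1) (sqr_leq _ s2); clear sqr_leq s0 s1 s2.
(* The quadratic terms cancel exactly, leaving [36 * m + 18 * r <= 0] against [0 < m + r]. *)
rewrite cardT in t_gt0 low *; move: cardM => <- *; lia.
Qed.

Lemma rainbow_of_edges (T : finType) (G : 'I_3 -> digraph T) :
  0 < #|T| -> (forall i, 5 * #|T| ^ 2 <= 9 * #|edges (G i)|) ->
  exists (u v w : T) (a b d : 'I_3), rainbow_directed_triangle G u v w a b d.
Proof.
move=> T_gt0 bound.
pose L u v : label := (G (@Ordinal 3 0 isT) u v, G (@Ordinal 3 1 isT) u v,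
                       G (@Ordinal 3 2 isT) u v).
have LE (j : 'I_3) u v : has_colour j (L u v) = G j u v.
  by case: j => [[|[|[|//]]] lt_j]; congr (edge (G _) u v); apply: val_inj.
have LI u : L u u = (false, false, false) by rewrite /L !edge_irrefl.
have edgesE (j : 'I_3) : \sum_u \sum_v has_colour j (L u v) = #|edges (G j)|.
  rewrite pair_big -sum1_card [RHS]big_mkcond; apply: eq_bigr => -[u v] _.
  by rewrite LE inE /=; case: (G j u v).
have [//|//|j|u [v [w]]] := @dense_rainbow T L.
  have [i [k ijk]] := other_colours j.
  (* Summing over ordered pairs meets each arc twice, so that 2 * (5/9 + 5/9) = 20/9. *)
  suff -> : pair_sum (mult_but L j) setT setT =
      2 * (#|edges (G i)| + #|edges (G k)|).
    by have := bound i; have := bound k; lia.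
  rewrite /pair_sum /mult_but.
  under eq_bigr do (under eq_bigl do rewrite inE; rewrite big_split).
  under eq_bigl do rewrite inE.
  rewrite big_split /= [X in _ + X]exchange_big addnn -mul2n.
  rewrite -!edgesE -big_split; congr (2 * _); apply: eq_bigr => u _.
  by rewrite -big_split; apply: eq_bigr => v _; rewrite (ncol_but_others _ ijk).
case/rainbow_colours=> a [b [d [abd]]]; rewrite !LE => uv vw wu.
exists u, v, w, a, b, d; split=> //; rewrite ?inE //.
have neq x y j : G j x y -> x != y.
  by apply: contraTneq => ->; rewrite edge_irrefl.
by rewrite /= !inE negb_or (neq _ _ _ uv) (neq _ _ _ vw) eq_sym (neq _ _ _ wu).
Qed.

Local Open Scope ring_scope.

Theorem theorem2 (T : finType) (n : nat) (G : 'I_3 -> digraph T)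
    (n_gt0 : (0 < n)%N) (card_T : #|T| = n)
    (edge_bound : forall i : 'I_3,
       5%:R / 9%:R * n%:R ^+ 2 <= #|edges (G i)|%:R :> rat) :
  exists (u v w : T) (a b d : 'I_3),
    rainbow_directed_triangle G u v w a b d.
Proof.
apply: rainbow_of_edges => [|i]; rewrite card_T //.
rewrite -(ler_nat rat) natrM natrX natrM; have := edge_bound i; lra.
Qed.
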